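(* Let $\mathcal{H}$ be a complex Hilbert space, let $T\in\mathcal{B}(\mathcal{H})$ be generalized Drazin invertible with closed range, let $T^{-}$ be a fixed inner inverse of $T$ and let $T^{GD-}=T^dTT^{-}$ be the corresponding GD1 inverse. Then $TT^{GD-}=T^{GD-}T$ if and only if $T^{GD-}=T^d$.
   Context: $\mathcal{B}(\mathcal{H})$ is the space of bounded linear operators on $\mathcal{H}$. An operator $Q$ is quasinilpotent if $\|Q^n\|^{1/n}\to0$. $T\in\mathcal{B}(\mathcal{H})$ is generalized Drazin invertible if there is $X\in\mathcal{B}(\mathcal{H})$ with $XTX=X$, $TX=XT$ and $T-T^2X$ quasinilpotent; such an $X$ is unique and is denoted $T^d$. An inner inverse of $T$ is $T^{-}\in\mathcal{B}(\mathcal{H})$ with $TT^{-}T=T$ (one exists iff the range of $T$ is closed). *)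

(* Defs.v *)
From HB Require Import structures.
From mathcomp Require Import all_boot all_order all_algebra.
From mathcomp Require Import all_classical all_reals all_analysis.
From mathcomp Require Import complex.

Set Implicit Arguments.
Unset Strict Implicit.
Unset Printing Implicit Defensive.

Import Order.TTheory GRing.Theory Num.Theory.
Import numFieldNormedType.Exports.

Local Open Scope classical_set_scope.
Local Open Scope ring_scope.
Local Open Scope complex_scope.

(* The inner product is linear in its first argument and conjugate-linear in
   the second, and it induces the norm (which is [R[i]]-valued, as for any
   normed module over [R[i]]). *)
HB.mixin Record CompleteNormedModule_isHilbert (R : realType) H
    of CompleteNormedModule R[i] H := {
  inner : {dot H for @Num.conj R[i]} ;
  normr_inner : forall x : H, `|x| ^+ 2 = inner x x
}.

#[short(type="hilbertType")]
HB.structure Definition Hilbert (R : realType) :=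
  {H of CompleteNormedModule R[i] H & CompleteNormedModule_isHilbert R H}.

Record boundedOp (K : numFieldType) (H : normedModType K) := BoundedOp {
  bop_fun :> H -> H ;
  bop_linear : linear bop_fun ;
  bop_bounded : exists M : K, forall x, `|bop_fun x| <= M * `|x|
}.

Section BoundedOpRing.
Context (K : numFieldType) (H : normedModType K).
Implicit Types S T U : boundedOp H.

HB.instance Definition _ T :=
  GRing.isLinear.Build K H H *:%R (bop_fun T) (bop_linear T).

Lemma bop_ext S T : S =1 T -> S = T.
Proof.
case: S T => [f lf bf] [g lg bg] /= /funext fg; subst g.
by rewrite (Prop_irrelevance lf lg) (Prop_irrelevance bf bg).
Qed.

Lemma bop_bound_ge0 T : exists2 M : K, 0 <= M & forall x, `|T x| <= M * `|x|.
Proof.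
have [M TM] := bop_bounded T.
have [H0|/existsNP[x /eqP x0]] := pselect (forall x : H, x = 0).
  by exists 0 => // x; rewrite (H0 (T x)) normr0 mul0r.
exists M => //; rewrite -(pmulr_lge0 _ (_ : 0 < `|x|)) ?normr_gt0//.
exact: le_trans (TM x).
Qed.

Lemma bop0_linear : linear (fun _ : H => 0 : H).
Proof. by move=> a x y; rewrite scaler0 addr0. Qed.

Lemma bop0_bounded : exists M : K, forall x : H, `|0 : H| <= M * `|x|.
Proof. by exists 0 => x; rewrite normr0 mul0r. Qed.

Lemma bop1_linear : linear (fun x : H => x).
Proof. by []. Qed.

Lemma bop1_bounded : exists M : K, forall x : H, `|x| <= M * `|x|.
Proof. by exists 1 => x; rewrite mul1r. Qed.

Lemma bopN_linear T : linear (fun x => - T x).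
Proof. by move=> a x y; rewrite linearP opprD scalerN. Qed.

Lemma bopN_bounded T : exists M : K, forall x, `|- T x| <= M * `|x|.
Proof. by have [M TM] := bop_bounded T; exists M => x; rewrite normrN. Qed.

Lemma bopD_linear S T : linear (fun x => S x + T x).
Proof. by move=> a x y; rewrite !linearP scalerDr addrACA. Qed.

Lemma bopD_bounded S T : exists M : K, forall x, `|S x + T x| <= M * `|x|.
Proof.
have [M SM] := bop_bounded S; have [N TN] := bop_bounded T.
by exists (M + N) => x; rewrite mulrDl (le_trans (ler_normD _ _))// lerD.
Qed.

Lemma bopM_linear S T : linear (fun x => S (T x)).
Proof. by move=> a x y; rewrite !linearP. Qed.

Lemma bopM_bounded S T : exists M : K, forall x, `|S (T x)| <= M * `|x|.
Proof.
have [M M0 SM] := bop_bound_ge0 S; have [N TN] := bop_bounded T.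
exists (M * N) => x; apply: le_trans (SM _) _.
by rewrite -mulrA ler_wpM2l.
Qed.

Definition bop0 := BoundedOp bop0_linear bop0_bounded.
Definition bop1 := BoundedOp bop1_linear bop1_bounded.
Definition bopN T := BoundedOp (bopN_linear T) (bopN_bounded T).
Definition bopD S T := BoundedOp (bopD_linear S T) (bopD_bounded S T).
Definition bopM S T := BoundedOp (bopM_linear S T) (bopM_bounded S T).

HB.instance Definition _ := gen_eqMixin (boundedOp H).
HB.instance Definition _ := gen_choiceMixin (boundedOp H).

Fact bop_addA : associative bopD.
Proof. by move=> S T U; apply: bop_ext => x /=; rewrite addrA. Qed.
Fact bop_addC : commutative bopD.
Proof. by move=> S T; apply: bop_ext => x /=; rewrite addrC. Qed.
Fact bop_add0 : left_id bop0 bopD.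
Proof. by move=> S; apply: bop_ext => x /=; rewrite add0r. Qed.
Fact bop_addN : left_inverse bop0 bopN bopD.
Proof. by move=> S; apply: bop_ext => x /=; rewrite addNr. Qed.

HB.instance Definition _ := GRing.isZmodule.Build (boundedOp H)
  bop_addA bop_addC bop_add0 bop_addN.

Fact bop_mulA : associative bopM.
Proof. by move=> S T U; apply: bop_ext. Qed.
Fact bop_mul1l : left_id bop1 bopM.
Proof. by move=> S; apply: bop_ext. Qed.
Fact bop_mul1r : right_id bop1 bopM.
Proof. by move=> S; apply: bop_ext. Qed.
Fact bop_mulDl : left_distributive bopM bopD.
Proof. by move=> S T U; apply: bop_ext. Qed.
Fact bop_mulDr : right_distributive bopM bopD.
Proof. by move=> S T U; apply: bop_ext => x /=; rewrite linearD. Qed.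

(* The ring structure may be trivial since [H] may be the zero space. *)
HB.instance Definition _ := GRing.Zmodule_isPzRing.Build (boundedOp H)
  bop_mulA bop_mul1l bop_mul1r bop_mulDl bop_mulDr.

End BoundedOpRing.

Section GeneralizedDrazin.
Context (R : realType) (H : normedModType R[i]).
Implicit Types Q T X Y : boundedOp H.

(* [normr] on [H] is [R[i]]-valued with zero imaginary part; [complex.Re]
   recovers the real number, so that the supremum is taken in [R]. *)
Definition opnorm T : R :=
  sup [set complex.Re `|T x| | x in [set x : H | `|x| <= 1]].

(* The exponent at [n = 0] is [0^-1 = 0], which does not affect the limit. *)
Definition quasinilpotent Q : Prop :=
  (fun n : nat => opnorm (Q ^+ n) `^ n%:R^-1) @ \oo --> (0 : R).

Definition gdrazin_inverse T X : Prop :=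
  [/\ X * T * X = X, T * X = X * T & quasinilpotent (T - T ^+ 2 * X)].

Definition gdrazin_invertible T : Prop := exists X, gdrazin_inverse T X.

(* [0] is a junk value when [T] is not generalized Drazin invertible; otherwise
   the chosen inverse is the only one, see [gdrazinP] and
   [gdrazin_inverse_unique]. *)
Definition gdrazin T : boundedOp H := xget 0 [set X | gdrazin_inverse T X].

Definition inner_inverse T X : Prop := T * X * T = T.

Definition GD1_inverse T Tm : boundedOp H := gdrazin T * T * Tm.

End GeneralizedDrazin.

Section GeneralizedDrazinTheory.
Context (R : realType) (H : normedModType R[i]).
Implicit Types Q T X Y Z : boundedOp H.

Let nrm (x : H) : R := complex.Re `|x|.

Let nrmE x : `|x| = (nrm x)%:C.
Proof. by rewrite RRe_real// normr_real. Qed.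

Let nrm_ge0 x : 0 <= nrm x.
Proof. by rewrite -ler0c -nrmE. Qed.

Let bop_nrm_bound T : exists2 M : R, 0 < M & forall x, nrm (T x) <= M * nrm x.
Proof.
have [M M0 TM] := bop_bound_ge0 T.
have ME : M = (complex.Re M)%:C by rewrite RRe_real// ger0_real.
have RM0 : 0 <= complex.Re M by rewrite -ler0c -ME.
exists (complex.Re M + 1) => [|x]; first by rewrite ltr_wpDl.
rewrite (@le_trans _ _ (complex.Re M * nrm x))//.
  by have := TM x; rewrite !nrmE ME -rmorphM/= lecR.
by rewrite ler_wpM2r// lerDl.
Qed.

Lemma opnorm_has_ubound T :
  has_ubound [set complex.Re `|T x| | x in [set x : H | `|x| <= 1]].
Proof.
have [M M0 TM] := bop_nrm_bound T.
exists M => _ [x /= x1 <-]; apply: (le_trans (TM x)).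
by rewrite -[leRHS]mulr1 ler_pM2l// -lecR -nrmE.
Qed.

Lemma opnorm_ge0 T : 0 <= opnorm T.
Proof.
apply: (ub_le_sup (opnorm_has_ubound T)); exists 0; first by rewrite /= normr0.
by rewrite linear0 normr0.
Qed.

Lemma opnormP T x : `|T x| <= (opnorm T)%:C * `|x|.
Proof.
have [->|x0] := eqVneq x 0; first by rewrite linear0 !normr0 mulr0.
have nx0 : 0 < `|x| by rewrite normr_gt0.
rewrite -ler_pdivrMr//.
have -> : `|T x| / `|x| = `|T (`|x|^-1 *: x)|.
  by rewrite linearZ normrZ normfV normr_id mulrC.
rewrite nrmE lecR; apply: (ub_le_sup (opnorm_has_ubound T)).
exists (`|x|^-1 *: x) => //=.
by rewrite normrZ normfV normr_id mulVf// gt_eqF.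
Qed.

Let nrm_opnorm T x : nrm (T x) <= opnorm T * nrm x.
Proof. by have := opnormP T x; rewrite !nrmE -rmorphM/= lecR. Qed.

Let nrm_expr Y (M : R) n x : 0 <= M -> (forall x, nrm (Y x) <= M * nrm x) ->
  nrm ((Y ^+ n) x) <= M ^+ n * nrm x.
Proof.
move=> M0 YM; elim: n x => [|n IH] x; first by rewrite !expr0 mul1r.
rewrite !exprSr; apply: (le_trans (IH (Y x))); rewrite -[leRHS]mulrA.
by apply: ler_wpM2l (YM x); exact: exprn_ge0.
Qed.

Let quasinilpotent_eq0 Q Y Z : quasinilpotent Q ->
  (forall M, 0 < M -> (forall x, nrm (Y x) <= M * nrm x) ->
    forall n x, (0 < n)%N -> nrm (Z x) <= M ^+ n * (opnorm (Q ^+ n) * nrm x)) ->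
  Z = 0.
Proof.
move=> Q0 ZQ; have [M M0 YM] := bop_nrm_bound Y.
apply: bop_ext => x; apply/eqP; rewrite -normr_eq0 nrmE/=.
suff Zx0 : nrm (Z x) <= 0 by rewrite (le_anti (introT andP (conj Zx0 (nrm_ge0 _)))).
have /cvgr0_norm_lt/(_ (2 * M)^-1) := Q0.
rewrite invr_gt0 mulr_gt0// => /(_ isT) Qlt.
have gcvg : geometric (nrm x) (2^-1 : R) n @[n --> \oo] --> 0.
  by apply: cvg_geometric; rewrite gtr0_norm ?invf_lt1 ?ltr1n.
apply: (@closed_cvg _ _ \oo _ _ (fun y : R => nrm (Z x) <= y) _ _ _ gcvg).
  exact: closed_ge.
near=> n; have n0 : (0 < n)%N by near: n; exists 1%N.
apply: (le_trans (ZQ _ M0 YM n x n0)); rewrite /geometric/= mulrA [leRHS]mulrC.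
apply: ler_wpM2r => //.
suff : opnorm (Q ^+ n) <= (2 * M)^-1 ^+ n.
  move=> /(ler_wpM2l (exprn_ge0 n (ltW M0)))/le_trans; apply.
  by rewrite -exprMn invfM mulrCA divff ?gt_eqF// mulr1.
have -> : opnorm (Q ^+ n) = (opnorm (Q ^+ n) `^ n%:R^-1) ^+ n.
  by rewrite -powR_mulrn ?powR_ge0// -powRrM mulVf ?pnatr_eq0 -?lt0n// powRr1// opnorm_ge0.
rewrite lerXn2r ?nnegrE ?powR_ge0 ?invr_ge0 ?mulr_ge0 ?(ltW M0)//.
rewrite (le_trans (ler_norm _))// ltW//; near: n; exact: Qlt.
Unshelve. all: by end_near. Qed.

Let quasinilpotent_mulXl Q Y Z : quasinilpotent Q ->
  (forall n, (0 < n)%N -> Z = Y ^+ n * Q ^+ n) -> Z = 0.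
Proof.
move=> Q0 ZE; apply: (quasinilpotent_eq0 (Y := Y) Q0) => M M0 YM n x n0.
rewrite (ZE n n0); apply: (le_trans (nrm_expr n ((Q ^+ n) x) (ltW M0) YM)).
by apply: ler_wpM2l; [rewrite exprn_ge0// ltW|exact: nrm_opnorm].
Qed.

Let quasinilpotent_mulXr Q Y Z : quasinilpotent Q ->
  (forall n, (0 < n)%N -> Z = Q ^+ n * Y ^+ n) -> Z = 0.
Proof.
move=> Q0 ZE; apply: (quasinilpotent_eq0 (Y := Y) Q0) => M M0 YM n x n0.
rewrite (ZE n n0); apply: (le_trans (nrm_opnorm (Q ^+ n) ((Y ^+ n) x))); rewrite [leRHS]mulrCA.
by apply: ler_wpM2l; [exact: opnorm_ge0|exact: (nrm_expr n _ (ltW M0) YM)].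
Qed.

Let idem_expr Z n : Z * Z = Z -> (0 < n)%N -> Z ^+ n = Z.
Proof.
move=> ZZ; case: n => // n _; elim: n => [|n IH]; first by rewrite expr1.
by rewrite exprS IH.
Qed.

Let idem_compl Z : Z * Z = Z -> (1 - Z) * (1 - Z) = 1 - Z.
Proof. by move=> ZZ; rewrite mulrBr mulr1 mulrBl mul1r ZZ subrr subr0. Qed.

Lemma gdrazin_inverse_unique T X Y :
  gdrazin_inverse T X -> gdrazin_inverse T Y -> X = Y.
Proof.
move=> [XTX TX QX] [YTY TY QY].
have idX : (T * X) * (T * X) = T * X by rewrite -mulrA (mulrA X) XTX.
have idY : (T * Y) * (T * Y) = T * Y by rewrite -mulrA (mulrA Y) YTY.
have QE U : T - T ^+ 2 * U = T * (1 - T * U).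
  by rewrite mulrBr mulr1 mulrA.
have cTU U : T * U = U * T -> GRing.comm T (1 - T * U).
  by move=> TU; rewrite /GRing.comm mulrBr mulrBl mulr1 mul1r -mulrA -TU.
have e1 : (1 - T * Y) * (T * X) = 0.
  apply: (quasinilpotent_mulXr (Y := X) QY) => n n0.
  rewrite QE exprMn_comm ?(commrX n (cTU _ TY))//; last exact: cTU.
  rewrite (idem_expr (idem_compl idY) n0).
  have -> : T ^+ n * (1 - T * Y) = (1 - T * Y) * T ^+ n.
    by apply/commr_sym/commrX/commr_sym/cTU.
  by rewrite -mulrA -exprMn_comm// (idem_expr idX n0).
have e2 : (T * Y) * (1 - T * X) = 0.
  apply: (quasinilpotent_mulXl (Y := Y) QX) => n n0.
  rewrite QE exprMn_comm; last exact: cTU.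
  rewrite (idem_expr (idem_compl idX) n0) mulrA -exprMn_comm -?TY//.
    by rewrite (idem_expr idY n0).
have TXY : T * X = T * Y.
  move/eqP: e1; rewrite mulrBl mul1r subr_eq0 => /eqP ->.
  by move/eqP: e2; rewrite mulrBr mulr1 subr_eq0 => /eqP <-.
by rewrite -XTX -mulrA TXY mulrA -TX TXY TY YTY.
Qed.

Lemma gdrazinP T : gdrazin_invertible T -> gdrazin_inverse T (gdrazin T).
Proof. exact: xgetPex. Qed.

End GeneralizedDrazinTheory.

(* Main.v *)
Require Import Defs.
From HB Require Import structures.
From mathcomp Require Import all_boot all_order all_algebra.
From mathcomp Require Import all_classical all_reals all_analysis.
From mathcomp Require Import complex.
Import Order.TTheory GRing.Theory Num.Theory.
Import numFieldNormedType.Exports.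
Local Open Scope classical_set_scope.
Local Open Scope ring_scope.

Theorem theorem4 (R : realType) (H : hilbertType R) (T Tm : boundedOp H)
    (T_gdrazin : gdrazin_invertible T)
    (T_closed : closed (range T))
    (Tm_inner : inner_inverse T Tm) :
  T * GD1_inverse T Tm = GD1_inverse T Tm * T <->
  GD1_inverse T Tm = gdrazin T.
Proof.
have [XTX TX _] := gdrazinP T_gdrazin.
rewrite /GD1_inverse; split=> [TG|->]; last exact: TX.
have GT : gdrazin T * T * Tm * T = T * gdrazin T.
  by rewrite -!mulrA (mulrA T Tm) Tm_inner TX.
move: TG; rewrite GT => /(congr1 (GRing.mul (gdrazin T))).
by rewrite !mulrA !XTX.
Qed.
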